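(* Let $f:\mathbb{R}^n\to\mathbb{R}$ satisfy the first-order assumption stated in the context; if $L_2^\tau$ is required by the subroutine $\mathcal{A}$ in addition, let $f$ also satisfy the second-order assumption stated in the context. Let $\{x_k^\tau\}_{k=0,\dots,K_\tau}^{\tau=1,2,\dots}$ be generated by the SLO algorithm with subroutine $\mathcal{A}$, tolerance $\epsilon>0$ and constants $D>0$, $d\ge 0$. If the algorithmic parameters and the subroutine $\mathcal{A}$ can simultaneously guarantee the Sufficient Descent condition (with constants $C_1^\tau,C_2^\tau$) and $$\sum_{\tau=1}^\infty \frac{\sqrt{C_1^\tau C_2^\tau}}{2}\,D=+\infty,\qquad\text{with}\qquad D\ge \frac12\sqrt{\frac{C_2^\tau}{C_1^\tau}}+2d\quad\text{for all }\tau ,$$ then it takes at most $T$ epochs to output a point $x_k^\tau$ with $\|\nabla f(x_k^\tau)\|^2\le\epsilon$, where $T$ satisfies $$T\le \inf\Big\{\tau+1:\ \sum_{k=1}^{\tau}\frac{\sqrt{C_1^kC_2^k}}{2}\,D\ \ge\ f(x_0^1)-f^*\Big\}<+\infty .$$ The total number of gradient evaluations of the algorithm is at most $$\sum_{\tau=1}^T K_\tau N_{\mathcal{A}}^\tau\ \le\ \max_{1\le\tau\le T}\Big\{\frac{N_{\mathcal{A}}^\tau}{C_2^\tau}\Big\}\cdot\big(f(x_0^1)-f^*\big)+\sum_{\tau=1}^T N_{\mathcal{A}}^\tau .$$ Its dependence on $\epsilon$ and $\mathcal{L}_1(\cdot)$ (and $\mathcal{L}_2(\cdot)$ if used) is characterized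 by $T$, $C_1^\tau$ and $C_2^\tau$.
   Context: Norms are Euclidean and $B(x,r)$ is the ball of radius $r$ centered at $x$. First-order assumption: (1) $f^*:=\inf_x f(x)>-\infty$. (2) $f$ is continuously differentiable, and $\nabla f$ is locally Lipschitz continuous everywhere but not globally Lipschitz continuous: $\nabla f$ is $\mathcal{L}_1(C)$-Lipschitz continuous within any compact set $C\subsetneq\mathbb{R}^n$, and without loss of generality $\mathcal{L}_1(C)\ge1$. (3) For any ball $B(x,r)$ of moderate radius $r=\mathcal{O}(1)$, $\mathcal{L}_1(B(x,r))$ is either explicitly known or can be estimated efficiently. Second-order assumption: $f$ is twice continuously differentiable and, for any compact $C\subsetneq\mathbb{R}^n$, $\|\nabla^2f(x)-\nabla^2f(y)\|\le\mathcal{L}_2(C)\|x-y\|$ for all $x,y\in C$, where without loss of generality $\mathcal{L}_2(\cdot)\ge1$. For any ball $B(x,r)$ of moderate radius $r=\mathcal{O}(1)$, $\mathcal{L}_2(B(x,r))$ is either explicitly known or can be estimated efficiently. SLO algorithm. Inputs: initial point $x_0^1$, $\epsilon>0$, $D>0$, $d\ge0$, subroutine $\mathcal{A}$. For epochs $\tau=1,2,\dots$: set $L_1^\tau=\mathcal{L}_1(B(x_0^\tau,D))$ if $\mathcal{A}$ requires it and $L_2^\tau=\mathcal{L}_2(B(x_0^\tau,D))$ if $\mathcal{A}$ requires it (otherwise they are null). For $k=0,1,2,\dots$: (a) if $\|\nabla f(x_k^\tau)\|<\sqrt\epsilon$, terminate the whole algorithm and return $x_k^\tau$; (b) generate $x_{k+1}^\tau=\mathcal{A}(f,x_k^\tau;L_1^\tau,L_2^\tau;x_0^\tau,D,d)$,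 where $\mathcal{A}$ is required to satisfy $\|x_{k+1}^\tau-x_0^\tau\|\le D$; (c) if $\|x_{k+1}^\tau-x_0^\tau\|\in[D-d,D]$, set $x_0^{\tau+1}=x_{k+1}^\tau$, end epoch $\tau$ and start epoch $\tau+1$. $x_{K_\tau}^\tau$ denotes the last iterate of epoch $\tau$. Sufficient Descent condition: there are functions $C_1(\cdot)>0$, $C_2(\cdot)>0$ such that, with $C_i^\tau:=C_i(L_1^\tau,L_2^\tau,\epsilon)$, $f(x_k^\tau)-f(x_{k-1}^\tau)\le -C_1^\tau\|x_k^\tau-x_{k-1}^\tau\|^2$ for $k=1,\dots,K_\tau$, and $f(x_k^\tau)-f(x_{k-1}^\tau)\le -C_2^\tau$ for $k=1,\dots,K_\tau-1$. $N_{\mathcal{A}}^\tau$ is the number of gradient evaluations in each execution of $\mathcal{A}$ in epoch $\tau$. *)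

(* Defs.v *)
From mathcomp Require Import all_boot all_order all_algebra.
From mathcomp Require Import all_classical all_reals all_analysis.

Set Implicit Arguments.
Unset Strict Implicit.
Unset Printing Implicit Defensive.

Import Order.TTheory GRing.Theory Num.Theory.
Import numFieldNormedType.Exports.

Local Open Scope classical_set_scope.
Local Open Scope ring_scope.

Section EuclideanSpace.
Context {R : realType} {n : nat}.

(* The norm that the library puts on 'rV[R]_n is the sup norm.  It induces the
   same topology (compactness, continuity, differentiability), but metric
   statements need the Euclidean norm. *)
Definition enorm (v : 'rV[R]_n) : R := Num.sqrt (\sum_i v ord0 i ^+ 2).

Definition eball (c : 'rV[R]_n) (r : R) : set 'rV[R]_n :=
  [set y | enorm (y - c) <= r].

Definition opnorm (M : 'M[R]_n) : R :=
  sup [set enorm (v *m M) | v in [set v : 'rV[R]_n | enorm v <= 1]].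

Definition grad (f : 'rV[R]_n -> R) (x : 'rV[R]_n) : 'rV[R]_n :=
  \row_i 'D_(delta_mx ord0 i) f x.

Definition hess (f : 'rV[R]_n -> R) (x : 'rV[R]_n) : 'M[R]_n := 'J (grad f) x.

Definition first_order_assumption (f : 'rV[R]_n -> R)
    (L1 : set 'rV[R]_n -> R) : Prop :=
  [/\ has_lbound (range f),
      (forall x, differentiable f x) /\ continuous (grad f),
      ~ (exists L : R, forall x y,
           enorm (grad f x - grad f y) <= L * enorm (x - y)) &
      forall C : set 'rV[R]_n, compact C -> C <> setT ->
        1 <= L1 C /\
        forall x y, C x -> C y ->
          enorm (grad f x - grad f y) <= L1 C * enorm (x - y)].

Definition second_order_assumption (f : 'rV[R]_n -> R)
    (L2 : set 'rV[R]_n -> R) : Prop :=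
  [/\ (forall x, differentiable f x) /\ continuous (grad f),
      (forall x, differentiable (grad f) x) /\ continuous (hess f) &
      forall C : set 'rV[R]_n, compact C -> C <> setT ->
        1 <= L2 C /\
        forall x y, C x -> C y ->
          opnorm (hess f x - hess f y) <= L2 C * enorm (x - y)].

End EuclideanSpace.

(* The arguments of [next] and [grad_evals] are those of
   A(f, x_k; L_1, L_2; x_0, D, d), a null constant being [None];
   [grad_evals] is the number of gradients evaluated by that execution. *)
Record subroutine (R : realType) (n : nat) := Subroutine {
  needs_L1 : bool;
  needs_L2 : bool;
  next : ('rV[R]_n -> R) -> 'rV[R]_n -> option R -> option R ->
         'rV[R]_n -> R -> R -> 'rV[R]_n;
  grad_evals : ('rV[R]_n -> R) -> 'rV[R]_n -> option R -> option R ->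
         'rV[R]_n -> R -> R -> nat
}.

(* Epochs [t] are numbered from 1 and [x t k] is the k-th iterate of epoch t.
   The function [x] is total, so that epochs may be infinite in number or in
   length; only the values at indices that are [reached] are produced by the
   algorithm. *)
Section Algorithm.
Context {R : realType} {n : nat}.
Variables (A : subroutine R n) (f : 'rV[R]_n -> R).
Variables (L1 L2 : set 'rV[R]_n -> R) (eps D d : R).
Variable x : nat -> nat -> 'rV[R]_n.

Definition epoch_L1 (t : nat) : option R :=
  if needs_L1 A then Some (L1 (eball (x t 0) D)) else None.

Definition epoch_L2 (t : nat) : option R :=
  if needs_L2 A then Some (L2 (eball (x t 0) D)) else None.

Definition stops (t k : nat) : bool := enorm (grad f (x t k)) < Num.sqrt eps.

Definition ends_epoch (t k : nat) : bool :=
  (0 < k)%N && (D - d <= enorm (x t k - x t 0) <= D).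

(* The end-of-epoch test takes place when [x t k] is generated, hence before
   its stopping test: an iterate passing both starts the next epoch, and the
   algorithm returns it there with k = 0. *)
Inductive reached : nat -> nat -> Prop :=
| reached_start : reached 1 0
| reached_next t k : reached t k -> ~~ ends_epoch t k -> ~~ stops t k ->
    reached t k.+1
| reached_epoch t k : reached t k -> ends_epoch t k -> reached t.+1 0.

(* [last_iterate t k] states that k = K_t. *)
Definition last_iterate (t k : nat) : Prop :=
  reached t k /\ (ends_epoch t k || stops t k).

Definition returns (t k : nat) : Prop :=
  [/\ reached t k, ~~ ends_epoch t k & stops t k].

Definition SLO_run (x01 : 'rV[R]_n) : Prop :=
  [/\ x 1 0 = x01,
      forall t k, reached t k.+1 ->
        x t k.+1 = next A f (x t k) (epoch_L1 t) (epoch_L2 t) (x t 0) D d,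
      forall t k, reached t k.+1 -> enorm (x t k.+1 - x t 0) <= D &
      forall t k, reached t k -> ends_epoch t k -> x t.+1 0 = x t k].

Definition epoch_const (c : option R -> option R -> R -> R) (t : nat) : R :=
  c (epoch_L1 t) (epoch_L2 t) eps.

Definition sufficient_descent (c1 c2 : option R -> option R -> R -> R) : Prop :=
  [/\ forall t, (1 <= t)%N -> 0 < epoch_const c1 t /\ 0 < epoch_const c2 t,
      forall t k, reached t k.+1 ->
        f (x t k.+1) - f (x t k)
          <= - epoch_const c1 t * enorm (x t k.+1 - x t k) ^+ 2 &
      forall t k, reached t k.+1 -> ~ last_iterate t k.+1 ->
        f (x t k.+1) - f (x t k) <= - epoch_const c2 t].

(* The number of gradients evaluated when x_{k+1}^t is generated. *)
Definition step_grad_evals (t k : nat) : nat :=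
  grad_evals A f (x t k) (epoch_L1 t) (epoch_L2 t) (x t 0) D d.

Definition total_grad_evals (T : nat) (K : nat -> nat) : nat :=
  (\sum_(1 <= t < T.+1) \sum_(0 <= k < K t) step_grad_evals t k)%N.

End Algorithm.

(* Main.v *)
Require Import Defs.
From mathcomp Require Import all_boot all_order all_algebra.
From mathcomp Require Import all_classical all_reals all_analysis.
From mathcomp Require Import ring lra.

Set Implicit Arguments.
Unset Strict Implicit.
Unset Printing Implicit Defensive.

Import Order.TTheory GRing.Theory Num.Theory.
Import numFieldNormedType.Exports.

Local Open Scope classical_set_scope.
Local Open Scope ring_scope.

(** The epoch is the unit of account.  Write C1, C2 for its constants, s for the
    length of a step and e for the decrease of f along it.

    A step that is not the last of its epoch has e >= C1 s^2 and e >= C2, hence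
    e >= sqrt (C1 C2) s ([le_geometric_mean]).  The last step only has
    e >= C1 s^2, and the tangent line of this parabola of slope sqrt (C1 C2)
    gives e >= sqrt (C1 C2) s - C2 / 4 ([tangent_le_quadratic]).  An epoch that
    ends by moving away covers at least the distance D - d, so by the triangle
    inequality it decreases f by sqrt (C1 C2) (D - d) - C2 / 4 or more.  The
    lower bound on D says exactly that this is at least sqrt (C1 C2) D / 2
    ([epoch_descent]).

    Epochs are finite, as f would otherwise decrease by C2 infinitely often
    ([epoch_finite]).  The decreases of successive epochs telescope, because an
    epoch starts where the previous one ended, and their sum cannot exceed
    f x01 - inf f ([sum_epoch_descent_le_gap]).  Since the guaranteed decreases
    have a divergent sum, some epoch T does not end by moving away, so that its
    last iterate is returned.  If the guarantees of the epochs 1, ..., t already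
    add up to f x01 - inf f, then epoch t + 1 cannot also be completed, as this
    would decrease f by a further positive amount; thus T <= t + 1.

    Finally, all steps of an epoch but the last decrease f by C2, so that K - 1
    is at most the decrease over the epoch divided by C2 ([epoch_length]);
    weighting by the cost of a step and summing over the epochs bounds the number
    of gradient evaluations. *)

(** * The Euclidean norm *)

Section EuclideanNorm.
Context {R : realType} {n : nat}.
Implicit Types u v w : 'rV[R]_n.

Lemma enorm_ge0 v : 0 <= enorm v.
Proof. exact: sqrtr_ge0. Qed.

Lemma enorm0 : enorm (0 : 'rV[R]_n) = 0.
Proof.
by rewrite /enorm big1 ?sqrtr0 // => i _; rewrite mxE expr0n.
Qed.

Lemma enorm_sqr v : enorm v ^+ 2 = \sum_i v ord0 i ^+ 2.
Proof. by rewrite sqr_sqrtr // sumr_ge0 // => i _; rewrite sqr_ge0. Qed.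

Lemma enorm_eq0 v : enorm v = 0 -> v = 0.
Proof.
move=> v0; apply/rowP => i; rewrite mxE; apply/eqP; rewrite -sqrf_eq0.
have /eqP : \sum_j v ord0 j ^+ 2 = 0 by rewrite -enorm_sqr v0 expr0n.
rewrite psumr_eq0 => [/allP/(_ i)|j _]; last exact: sqr_ge0.
by rewrite mem_index_enum; apply.
Qed.

(** The expansion of [0 <= \sum_i (|v| u_i - |u| v_i) ^+ 2] gives the inequality
    multiplied by [2 |u| |v|], which proves it when that factor is nonzero. *)
Lemma enorm_cauchy_schwarz u v :
  \sum_i u ord0 i * v ord0 i <= enorm u * enorm v.
Proof.
have [/enorm_eq0->|u0] := eqVneq (enorm u) 0.
  by rewrite enorm0 mul0r big1 // => i _; rewrite mxE mul0r.
have [/enorm_eq0->|v0] := eqVneq (enorm v) 0.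
  by rewrite enorm0 mulr0 big1 // => i _; rewrite mxE mulr0.
set a := enorm u in u0 *; set b := enorm v in v0 *.
have ab_gt0 : 0 < 2 * (a * b).
  by rewrite mulr_gt0// mulr_gt0// lt_neqAle eq_sym ?u0 ?v0 enorm_ge0.
rewrite -(ler_pM2l ab_gt0) -subr_ge0.
have -> : 2 * (a * b) * (a * b)
    - 2 * (a * b) * (\sum_i u ord0 i * v ord0 i)
    = \sum_i (b * u ord0 i - a * v ord0 i) ^+ 2.
  rewrite [RHS](eq_bigr (fun i => b ^+ 2 * u ord0 i ^+ 2
    + a ^+ 2 * v ord0 i ^+ 2 - 2 * (a * b) * (u ord0 i * v ord0 i)))
    => [|i _ /=]; last by ring.
  rewrite sumrB big_split/= -!mulr_sumr -!enorm_sqr -/a -/b; ring.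
by apply: sumr_ge0 => i _; rewrite sqr_ge0.
Qed.

Lemma enormD u v : enorm (u + v) <= enorm u + enorm v.
Proof.
rewrite -(@ler_pXn2r _ 2) ?nnegrE ?addr_ge0 ?enorm_ge0//.
rewrite enorm_sqr; under eq_bigr do rewrite mxE sqrrD.
rewrite !big_split/= -!enorm_sqr sqrrD lerD2r lerD2l.
by rewrite -mulr2n lerMn2r enorm_cauchy_schwarz.
Qed.

Lemma enorm_triangle u v w : enorm (u - w) <= enorm (u - v) + enorm (v - w).
Proof. by have := enormD (u - v) (v - w); rewrite addrA subrK. Qed.

End EuclideanNorm.

(** * Lower bounds on the decrease of one step *)

Section Descent.
Context {R : realType}.
Implicit Types a b s e : R.

Lemma sqrtrM_sqr a b : 0 < a -> 0 < b -> Num.sqrt (a * b) ^+ 2 = a * b.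
Proof. by move=> a0 b0; rewrite sqr_sqrtr// mulr_ge0 ?ltW. Qed.

(** A number above two nonnegative ones is above their geometric mean, here
    the one of [a * s ^+ 2] and [b]. *)
Lemma le_geometric_mean a b s e : 0 < a -> 0 < b -> 0 <= s ->
  a * s ^+ 2 <= e -> b <= e -> Num.sqrt (a * b) * s <= e.
Proof.
move=> a0 b0 s0 ase be.
have e0 : 0 <= e by apply: le_trans be; exact: ltW.
rewrite -(@ler_pXn2r _ 2) ?nnegrE ?mulr_ge0 ?sqrtr_ge0//.
rewrite exprMn sqrtrM_sqr// mulrAC [e ^+ 2]expr2 ler_pM//.
- by rewrite mulr_ge0 ?sqr_ge0 ?ltW.
- exact: ltW.
Qed.

(** The difference of the two sides is [(a s - sqrt (a b) / 2) ^+ 2 / a]: the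
    parabola lies above its tangent of slope [sqrt (a b)], the slope of the
    bound in [le_geometric_mean]. *)
Lemma tangent_le_quadratic a b s : 0 < a -> 0 < b ->
  Num.sqrt (a * b) * s - b / 4 <= a * s ^+ 2.
Proof.
move=> a0 b0; rewrite -subr_ge0 -(pmulr_rge0 _ a0).
have -> : a * (a * s ^+ 2 - (Num.sqrt (a * b) * s - b / 4))
    = (a * s - Num.sqrt (a * b) / 2) ^+ 2.
  have := sqrtrM_sqr a0 b0; set r := Num.sqrt _ => rE.
  rewrite (_ : (a * s - r / 2) ^+ 2 = a ^+ 2 * s ^+ 2 - a * s * r + r ^+ 2 / 4);
    last by field.
  by rewrite rE; field.
exact: sqr_ge0.
Qed.

Lemma sqrtrM_ratio a b : 0 < a -> 0 < b ->
  Num.sqrt (a * b) * Num.sqrt (b / a) = b.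
Proof.
move=> a0 b0; rewrite -sqrtrM ?mulr_ge0 ?ltW//.
rewrite (_ : a * b * (b / a) = b ^+ 2); last by field; rewrite gt_eqF.
by rewrite sqrtr_sqr ger0_norm ?ltW.
Qed.

End Descent.

(** * Descent within an epoch *)

Section SLO.
Context {R : realType} {n : nat}.
Variables (A : subroutine R n) (f : 'rV[R]_n -> R).
Variables (L1 L2 : set 'rV[R]_n -> R) (eps D d : R).
Variables (x01 : 'rV[R]_n) (x : nat -> nat -> 'rV[R]_n).
Variables (c1 c2 : option R -> option R -> R -> R).

Local Notation reached := (reached f eps D d x).
Local Notation ends_epoch := (ends_epoch D d x).
Local Notation stops := (stops f eps x).
Local Notation last_iterate := (last_iterate f eps D d x).
Local Notation C1 := (epoch_const A L1 L2 eps D x c1).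
Local Notation C2 := (epoch_const A L1 L2 eps D x c2).

Lemma reachedS_inv t k : reached t k.+1 -> reached t k /\ ~ last_iterate t k.
Proof.
move E : k.+1 => k1 h; case: h E => // t' k' h ne ns [->]; split=> //.
by move=> [_ /orP[e|s]]; [rewrite e in ne|rewrite s in ns].
Qed.

Lemma reached_le t k l : (l <= k)%N -> reached t k -> reached t l.
Proof.
move=> /subnK <-; elim: (k - l)%N => // m IH.
by rewrite addSn => /reachedS_inv[/IH].
Qed.

Lemma reached_gt0 {t k} : reached t k -> (1 <= t)%N.
Proof. by elim. Qed.

Hypothesis run : SLO_run A f L1 L2 eps D d x x01.
Hypothesis descent : sufficient_descent A f L1 L2 eps D d x c1 c2.

Lemma C1_gt0 t : (1 <= t)%N -> 0 < C1 t.
Proof. by case: descent => + _ _ => /(_ t)/[apply] -[]. Qed.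

Lemma C2_gt0 t : (1 <= t)%N -> 0 < C2 t.
Proof. by case: descent => + _ _ => /(_ t)/[apply] -[]. Qed.

(** The steps up to [x t k] all satisfy both descent conditions.  The first
    iterate needs the guard [(0 < k)%N]: it may be the last one of its epoch, but
    no step leads to it. *)
Lemma before_last_descent t k :
  reached t k -> ((0 < k)%N -> ~ last_iterate t k) ->
  k%:R * C2 t <= f (x t 0%N) - f (x t k) /\
  Num.sqrt (C1 t * C2 t) * enorm (x t k - x t 0) <= f (x t 0%N) - f (x t k).
Proof.
case: descent => _ quad cst.
elim: k => [|k IH] r nl; first by rewrite !subrr mul0r enorm0 mulr0.
have [rk nlk] := reachedS_inv r; have [i1 i2] := IH rk (fun=> nlk).
have t0 := reached_gt0 r.
have := quad _ _ r; have := cst _ _ r (nl isT) => h2 h1.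
split; first by rewrite -natr1 mulrDl mul1r; lra.
have h : Num.sqrt (C1 t * C2 t) * enorm (x t k.+1 - x t k)
    <= f (x t k) - f (x t k.+1).
  by apply: le_geometric_mean; rewrite ?C1_gt0 ?C2_gt0 ?enorm_ge0//; lra.
have := ler_wpM2l (sqrtr_ge0 (C1 t * C2 t))
  (enorm_triangle (x t k.+1) (x t k) (x t 0%N)).
rewrite mulrDr; lra.
Qed.

Lemma step_nonincreasing t k : reached t k.+1 -> f (x t k.+1) <= f (x t k).
Proof.
move=> r; case: descent => _ /(_ _ _ r) h _.
have : 0 <= C1 t * enorm (x t k.+1 - x t k) ^+ 2.
  by rewrite mulr_ge0 ?sqr_ge0// ltW// C1_gt0// (reached_gt0 r).
lra.
Qed.

(** One step less is counted because only the quadratic bound holds for the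
    last one; for [k = 0] the truncated predecessor makes the bound trivial. *)
Lemma epoch_length t k : reached t k ->
  k.-1%:R * C2 t <= f (x t 0%N) - f (x t k).
Proof.
case: k => [|k] r; first by rewrite subrr mul0r.
have [rk nlk] := reachedS_inv r.
have [h _] := before_last_descent rk (fun=> nlk).
have := step_nonincreasing r; rewrite /=; lra.
Qed.

Lemma epoch_nonincreasing t k : reached t k -> 0 <= f (x t 0%N) - f (x t k).
Proof.
move=> r; apply: le_trans (epoch_length r).
by rewrite mulr_ge0// ltW// C2_gt0// (reached_gt0 r).
Qed.

(** The last step loses [C2 t / 4] and the margin [d] of the exit test loses
    [sqrt (C1 t * C2 t) * d]; the lower bound on [D] multiplied by
    [sqrt (C1 t * C2 t) / 2] absorbs exactly these two losses. *)
Lemma epoch_descent t k :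
  2^-1 * Num.sqrt (C2 t / C1 t) + 2 * d <= D ->
  reached t k -> ends_epoch t k ->
  Num.sqrt (C1 t * C2 t) / 2 * D <= f (x t 0%N) - f (x t k).
Proof.
move=> hD r /andP[k0 /andP[far _]].
case: k k0 r far => // k _ r far.
have [rk nlk] := reachedS_inv r.
have [_ h] := before_last_descent rk (fun=> nlk).
have t0 := reached_gt0 r; have a0 := C1_gt0 t0; have b0 := C2_gt0 t0.
have quad : f (x t k.+1) - f (x t k)
    <= - C1 t * enorm (x t k.+1 - x t k) ^+ 2.
  by case: descent => _ /(_ _ _ r).
have tan := tangent_le_quadratic (enorm (x t k.+1 - x t k)) a0 b0.
have tri := ler_wpM2l (sqrtr_ge0 (C1 t * C2 t))
  (le_trans far (enorm_triangle (x t k.+1) (x t k) (x t 0%N))).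
have := ler_wpM2l (sqrtr_ge0 (C1 t * C2 t)) hD.
have := sqrtrM_ratio a0 b0.
set r1 := Num.sqrt (C1 t * C2 t) in h tan tri *.
set r2 := Num.sqrt (C2 t / C1 t) => rE.
rewrite mulrDr (mulrCA r1) rE => hDr.
rewrite mulrDr in tri; lra.
Qed.

Hypothesis lbf : has_lbound (range f).

Lemma inf_range_le y : inf (range f) <= f y.
Proof. by apply: ge_inf => //; exists y. Qed.

(** An infinite epoch would consist of steps that each decrease [f] by the same
    positive amount [C2 t], against the lower bound of [f]. *)
Lemma epoch_finite t : reached t 0 -> exists k, last_iterate t k.
Proof.
move=> r0; apply: contrapT => no_last.
have all k : reached t k.
  elim: k => // k IH; apply: reached_next => //; apply/negP => h;
    by apply: no_last; exists k; split=> //; rewrite h ?orbT.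
have b0 := C2_gt0 (reached_gt0 r0).
pose gap := f (x t 0%N) - inf (range f).
have [k kgap] : exists k, gap / C2 t < k%:R.
  exists (Num.trunc (gap / C2 t)).+1; exact: truncnS_gt.
have [|h _] := before_last_descent (all k).
  by move=> _ l; apply: no_last; exists k.
have := inf_range_le (x t k).
rewrite ltr_pdivrMr// /gap in kgap; lra.
Qed.

(** * Descent over successive epochs *)

Section Epochs.
Variable K : nat -> nat.
Hypothesis K_last : forall t, reached t 0 -> last_iterate t (K t).

Lemma reached_epochs t : (forall s, (1 <= s <= t)%N -> ends_epoch s (K s)) ->
  reached t.+1 0.
Proof.
elim: t => [_|t IH ends]; first exact: reached_start.
have r : reached t.+1 0.
  by apply: IH => s /andP[s1 st]; apply: ends; rewrite s1 leqW.
by apply: (@reached_epoch _ _ _ _ _ _ _ _ (K t.+1));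
  [exact: (K_last r).1|apply: ends; rewrite leqnn].
Qed.

Lemma sum_epoch_descent t : (forall s, (1 <= s <= t)%N -> ends_epoch s (K s)) ->
  \sum_(1 <= s < t.+1) (f (x s 0%N) - f (x s (K s))) = f x01 - f (x t.+1 0).
Proof.
case: run => x10 _ _ restart.
elim: t => [_|t IH ends]; first by rewrite big_geq// x10 subrr.
have ends' s : (1 <= s <= t)%N -> ends_epoch s (K s).
  by move=> /andP[s1 st]; apply: ends; rewrite s1 leqW.
have last := (K_last (reached_epochs ends')).1.
rewrite big_nat_recr//= IH// (restart _ _ last); last first.
  by apply: ends; rewrite leqnn.
by rewrite addrA subrK.
Qed.

(** The epoch [T] may be the one that returns: only the epochs before it have to
    restart where they end for the sum to telescope. *)
Lemma sum_epoch_descent_le_gap T :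
  (forall s, (1 <= s < T)%N -> ends_epoch s (K s)) ->
  \sum_(1 <= s < T.+1) (f (x s 0%N) - f (x s (K s))) <= f x01 - inf (range f).
Proof.
case: T => [_|T ends].
  by rewrite big_geq// subr_ge0 inf_range_le.
rewrite big_nat_recr//= sum_epoch_descent//.
have := inf_range_le (x T.+1 (K T.+1)); lra.
Qed.

End Epochs.

End SLO.

(** * Complexity of the algorithm *)

Lemma partial_sum_unbounded (R : realType) (u : nat -> R) (B : R) :
  (forall t, (1 <= t)%N -> 0 <= u t) ->
  (\sum_(1 <= t <oo) (u t)%:E = +oo)%E ->
  exists2 t, (1 <= t)%N & B <= \sum_(1 <= k < t.+1) u k.
Proof.
move=> u0 uoo; apply: contrapT => no.
have : (\sum_(1 <= t <oo) (u t)%:E <= B%:E)%E.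
  apply: lime_le.
    by apply: is_cvg_nneseries => t t1 _; rewrite lee_fin u0.
  exists 2%N => // -[|t] //= t1; rewrite sumEFin lee_fin leNgt; apply/negP => h.
  by apply: no; exists t => //; exact: ltW.
by rewrite uoo leye_eq.
Qed.

Theorem theorem2p4 (R : realType) (n : nat) (f : 'rV[R]_n -> R)
    (L1 L2 : set 'rV[R]_n -> R) (A : subroutine R n) (eps D d : R)
    (x01 : 'rV[R]_n) (x : nat -> nat -> 'rV[R]_n)
    (c1 c2 : option R -> option R -> R -> R) (N : nat -> nat)
    (C1 := epoch_const A L1 L2 eps D x c1)
    (C2 := epoch_const A L1 L2 eps D x c2)
    (fstar := inf (range f))
    (bound := ereal_inf [set ((t.+1)%:R%:E : \bar R) | t in
       [set t : nat | (1 <= t)%N /\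
          \sum_(1 <= k < t.+1) (Num.sqrt (C1 k * C2 k) / 2 * D)
            >= f x01 - fstar]]) :
  0 < eps -> 0 < D -> 0 <= d ->
  first_order_assumption f L1 ->
  (needs_L2 A -> second_order_assumption f L2) ->
  SLO_run A f L1 L2 eps D d x x01 ->
  sufficient_descent A f L1 L2 eps D d x c1 c2 ->
  (\sum_(1 <= t <oo) (Num.sqrt (C1 t * C2 t) / 2 * D)%:E = +oo)%E ->
  (forall t, (1 <= t)%N -> D >= 2^-1 * Num.sqrt (C2 t / C1 t) + 2 * d) ->
  (forall t k, reached f eps D d x t k.+1 ->
     step_grad_evals A f L1 L2 D d x t k = N t) ->
  exists (T : nat) (K : nat -> nat),
    [/\ (1 <= T)%N,
        forall t, (1 <= t <= T)%N -> last_iterate f eps D d x t (K t),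
        returns f eps D d x T (K T) /\ enorm (grad f (x T (K T))) ^+ 2 <= eps,
        ((T%:R)%:E <= bound)%E /\ (bound < +oo)%E &
        (total_grad_evals A f L1 L2 D d x T K)%:R
          <= \sum_(1 <= t < T.+1) (K t)%:R * (N t)%:R :> R /\
        \sum_(1 <= t < T.+1) (K t)%:R * (N t)%:R
          <= (\big[Num.max/0]_(1 <= t < T.+1) ((N t)%:R / C2 t))
               * (f x01 - fstar)
             + \sum_(1 <= t < T.+1) (N t)%:R].
Proof.
move=> eps0 D0 d0 [lbf _ _ _] _ run descent divergent hD hN.
have guaranteed_gt0 t : (1 <= t)%N -> 0 < Num.sqrt (C1 t * C2 t) / 2 * D.
  move=> t1; rewrite mulr_gt0// divr_gt0// sqrtr_gt0.
  by rewrite mulr_gt0 ?(C1_gt0 descent) ?(C2_gt0 descent).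
have [t0 t0_gt0 t0_large] : exists2 t, (1 <= t)%N &
    f x01 - fstar <= \sum_(1 <= k < t.+1) (Num.sqrt (C1 k * C2 k) / 2 * D).
  by apply: partial_sum_unbounded => // t /guaranteed_gt0/ltW.
have [K K_last] : {K : nat -> nat & forall t,
    reached f eps D d x t 0 -> last_iterate f eps D d x t (K t)}.
  apply: (@choice _ _ (fun t k => reached f eps D d x t 0 ->
    last_iterate f eps D d x t k)) => t.
  have [r|nr] := pselect (reached f eps D d x t 0); last by exists 0%N.
  by have [k] := epoch_finite descent lbf r; exists k.
have ended_le t (ends : forall s, (1 <= s <= t)%N -> ends_epoch D d x s (K s)) :
    \sum_(1 <= k < t.+1) (Num.sqrt (C1 k * C2 k) / 2 * D) <= f x01 - fstar.
  have before s : (1 <= s < t)%N -> ends_epoch D d x s (K s).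
    by move=> /andP[s1 st]; apply: ends; rewrite s1 ltnW.
  apply: le_trans (sum_epoch_descent_le_gap run lbf K_last before).
  rewrite !big_nat; apply: ler_sum => s /andP[s1 st].
  apply: (epoch_descent descent); rewrite ?hD ?ends ?s1//.
  apply: (K_last _ _).1; case: s s1 st => // s _ st.
  apply: (reached_epochs K_last) => s' /andP[s'1 s's].
  by apply: ends; rewrite s'1 (leq_trans s's) 1?ltnW.
(* Completing an epoch beyond [t'] would decrease [f] strictly below its
   infimum. *)
have ended_leq t t' : f x01 - fstar <=
      \sum_(1 <= k < t'.+1) (Num.sqrt (C1 k * C2 k) / 2 * D) ->
    (forall s, (1 <= s <= t)%N -> ends_epoch D d x s (K s)) ->
    (t <= t')%N.
  move=> t'_large ends; rewrite leqNgt; apply/negP => tt'.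
  have /le_trans/(_ t'_large) : \sum_(1 <= k < t'.+2)
      (Num.sqrt (C1 k * C2 k) / 2 * D) <= f x01 - fstar.
    apply: ended_le => s /andP[s1 st'].
    by apply: ends; rewrite s1 (leq_trans st').
  by rewrite big_nat_recr//= gerDl leNgt guaranteed_gt0.
(* The algorithm returns in the first epoch that does not end by moving away. *)
have [|T /andP[T1 nendsT] Tmin] :=
    @ex_minnP (fun t => (1 <= t)%N && ~~ ends_epoch D d x t (K t)).
  apply: contrapT => no; suff : (t0.+1 <= t0)%N by rewrite ltnn.
  apply: (ended_leq t0.+1 t0 t0_large) => s /andP[s1 _].
  by apply: contrapT => /negP ne; apply: no; exists s; rewrite s1.
have ends s : (1 <= s < T)%N -> ends_epoch D d x s (K s).
  move=> /andP[s1]; apply: contraTT => ne.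
  by rewrite -leqNgt; apply: Tmin; rewrite s1.
have reachedT t : (1 <= t <= T)%N -> reached f eps D d x t 0.
  case: t => // t /andP[_ tT]; apply: (reached_epochs K_last) => s /andP[s1 st].
  by apply: ends; rewrite s1 (leq_ltn_trans st).
have lastT t : (1 <= t <= T)%N -> last_iterate f eps D d x t (K t).
  by move=> /reachedT/K_last.
have [rT] : last_iterate f eps D d x T (K T) by apply: lastT; rewrite T1 leqnn.
rewrite (negbTE nendsT) => sT.
exists T, K; split=> //.
- split; first by [].
  rewrite -(sqr_sqrtr (ltW eps0)) ler_pXn2r ?nnegrE ?sqrtr_ge0 ?enorm_ge0//.
  exact: ltW.
- split.
    apply: le_ereal_inf_tmp => _ [t [t1 tS] <-]; rewrite lee_fin ler_nat.
    rewrite leqNgt; apply/negP => tT.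
    suff : (t.+1 <= t)%N by rewrite ltnn.
    apply: (ended_leq t.+1 t tS) => s /andP[s1 st].
    by apply: ends; rewrite s1 (leq_ltn_trans st).
  apply: (@le_lt_trans _ _ (t0.+1)%:R%:E); last exact: ltry.
  by apply: ereal_inf_lbound; exists t0.
- split.
    rewrite /total_grad_evals natr_sum big_nat [leRHS]big_nat.
    apply: ler_sum => t /lastT[rK _].
    rewrite big_nat (eq_bigr (fun=> N t)) => [|k /andP[_ kK]]; last first.
      by apply: hN; exact: reached_le rK.
    by rewrite -big_nat sum_nat_const_nat subn0 natrM.
  set M := \big[Num.max/0]_(_ <= _ < _) _.
  have M0 : 0 <= M by exact: bigmax_ge_id.
  apply: le_trans (lerD (ler_wpM2l M0
    (sum_epoch_descent_le_gap run lbf K_last ends)) (lexx _)).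
  rewrite mulr_sumr -big_split/= big_nat [leRHS]big_nat.
  apply: ler_sum => t tT; have [rK _] := lastT t tT.
  have C20 := C2_gt0 descent (reached_gt0 rK).
  have NM : (N t)%:R / C2 t <= M.
    apply: (@le_bigmax_seq _ _ _ _ 0 t xpredT (fun s => (N s)%:R / C2 s)) => //.
    by rewrite mem_index_iota ltnS.
  have := epoch_length descent rK; rewrite -ler_pdivlMr// => len.
  have : (K t)%:R <= (f (x t 0%N) - f (x t (K t))) / C2 t + 1 :> R.
    apply: le_trans (lerD len (lexx 1)).
    by rewrite natr1 ler_nat leqSpred.
  move=> /(ler_wpM2r (ler0n _ (N t)))/le_trans; apply.
  rewrite mulrDl mul1r lerD2r mulrAC -mulrA mulrC ler_wpM2r//.
  exact: (epoch_nonincreasing descent rK).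
Qed.
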